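(* Let $f=h+\overline{g}$ be a rational harmonic function, where $h$ and $g$ are rational functions, each of degree at least $2$ and each having a super-attracting fixed point in $\widehat{\mathbb{C}}$. Then $f$ has an $\mathfrak{h}$-fixed point $\zeta=\mu+\overline{\omega}$ (with $\mu,\omega\in\widehat{\mathbb{C}}$) whose multipliers $\lambda=\partial_z h(\mu)$ and $\theta=\partial_z g(\omega)$ satisfy $\operatorname{Re}(\lambda)\ge 1$ and $\operatorname{Re}(\theta)\ge 1$. In particular, this conclusion holds for every polynomial harmonic function $f=h+\overline{g}$, i.e. whenever $h$ and $g$ are both polynomials of degree at least $2$.
   Context: Here $\overline{g}$ denotes the function $z\mapsto\overline{g(z)}$ and $\widehat{\mathbb{C}}=\mathbb{C}\cup\{\infty\}$. A harmonic function $f=h+\overline{g}$ is called a rational (respectively polynomial) harmonic function if both $h$ and $g$ are rational functions (respectively polynomials) of degree at least $2$. Multipliers of fixed points: if $R$ is a rational function and $z_0\in\mathbb{C}$ with $R(z_0)=z_0$, the multiplier of $z_0$ is $R'(z_0)$; if $R(\infty)=\infty$, the multiplier of $\infty$ is the derivative at $0$ of the function $z\mapsto 1/R(1/z)$. A fixed point is super-attracting if its multiplier is $0$. $\mathfrak{h}$-fixed points: a finite $\mathfrak{h}$-fixed point of $f=h+\overline{g}$ is a complex number $\zeta=\mu+\overline{\omega}$, with $\mu,\omega\in\mathbb{C}$, such that $\mu+\overline{\omega}=h(\mu)+\overline{g(\omega)}$. Infinite $\mathfrak{h}$-fixed points are the formal expressions: $\mu+\overline{\infty}$ if $h(\mu)=\mu$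 and $g(\infty)=\infty$; $\infty+\overline{\omega}$ if $h(\infty)=\infty$ and $g(\omega)=\omega$; $\infty+\overline{\infty}$ if $h(\infty)=\infty$ and $g(\infty)=\infty$. The multipliers of an $\mathfrak{h}$-fixed point $\mu+\overline{\omega}$ are $\lambda=\partial_z h(\mu)=h'(\mu)$ and $\theta=\partial_z g(\omega)=g'(\omega)$, where at the point $\infty$ the multiplier of $h$ (respectively $g$) is taken to be the derivative at $0$ of the function $z\mapsto 1/h(1/z)$ (respectively $z\mapsto 1/g(1/z)$). *)

(* Defs.v *)
From mathcomp Require Import all_boot all_order all_algebra.
From mathcomp Require Import complex.
From mathcomp Require Import classical_sets reals topology normedtype derive.

Set Implicit Arguments.
Unset Strict Implicit.
Unset Printing Implicit Defensive.

Import Order.TTheory GRing.Theory Num.Theory.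
Import numFieldNormedType.Exports.

Local Open Scope ring_scope.
Local Open Scope complex_scope.

Definition sphere (R : realType) : Type := one_point_compactification R[i].

(* A rational function is a quotient of coprime polynomials; the pair is only
   determined up to a common nonzero scalar. *)
Record ratfun (R : realType) := Ratfun {
  rnum : {poly R[i]};
  rden : {poly R[i]};
  rden_neq0 : rden != 0;
  rcoprime : coprimep rnum rden }.

Definition rdegree (R : realType) (r : ratfun R) : nat :=
  maxn (size (rnum r)).-1 (size (rden r)).-1.

Definition ratfun_of_poly (R : realType) (p : {poly R[i]}) : ratfun R :=
  Ratfun (oner_neq0 {poly R[i]}) (coprimep1 p).

(* The action on the sphere. At infinity, if deg num <= deg den, then
   (rnum r)`_(deg den) is either the leading coefficient of the numerator
   (equal degrees) or zero. *)
Definition reval (R : realType) (r : ratfun R) (w : sphere R) : sphere R :=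
  match w with
  | Some z => if (rden r).[z] == 0 then None
              else Some ((rnum r).[z] / (rden r).[z])
  | None => if (size (rden r) < size (rnum r))%N then None
            else Some ((rnum r)`_(size (rden r)).-1 / lead_coef (rden r))
  end.

Definition sphere_inv (R : realType) (w : sphere R) : sphere R :=
  match w with
  | Some z => if z == 0 then None else Some z^-1
  | None => Some 0
  end.

(* The finite value of a point of the sphere; infinity is sent to the junk
   value 0. *)
Definition finite_part (R : realType) (w : sphere R) : R[i] :=
  if w is Some z then z else 0.

(* Stated over a numFieldType because R[i] itself carries no canonical
   normed-module structure; at K := R[i] this is the complex derivative. *)
Definition cderive (K : numFieldType) (u : K -> K) (z : K) : K := derive1 u z.

(* Only meaningful at finite points that are not poles, and at infinity when
   r fixes infinity. There the function being differentiated avoids the junk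
   value of finite_part near the point of differentiation. *)
Definition multiplier (R : realType) (r : ratfun R) (w : sphere R) : R[i] :=
  match w with
  | Some z0 => cderive (fun z => finite_part (reval r (Some z))) z0
  | None => cderive (fun z =>
      finite_part (sphere_inv (reval r (sphere_inv (Some z))))) 0
  end.

Definition has_superattracting_fixed_point (R : realType) (r : ratfun R) :=
  exists w : sphere R, reval r w = w /\ multiplier r w = 0.

(* f = h + conj g. The pair (h, g) is part of the data: replacing it by
   (h + c, g - c^* ) gives the same function but other infinite fixed points. *)
Record harmonic (R : realType) := Harmonic {
  hpart : ratfun R;
  gpart : ratfun R }.

Definition rational_harmonic (R : realType) (f : harmonic R) : Prop :=
  (2 <= rdegree (hpart f))%N /\ (2 <= rdegree (gpart f))%N.

(* h_fixed f mu omega: the expression mu + conj omega is an h-fixed point of f.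
   The pair is recorded, rather than the number mu + conj omega, because the
   multipliers depend on it. A finite one requires h and g to be finite at mu
   and omega, but mu and omega need not be fixed by h and g. *)
Inductive h_fixed (R : realType) (f : harmonic R) :
    sphere R -> sphere R -> Prop :=
| h_fixed_finite (mu omega a b : R[i]) :
    reval (hpart f) (Some mu) = Some a ->
    reval (gpart f) (Some omega) = Some b ->
    mu + omega^* = a + b^* ->
    h_fixed f (Some mu) (Some omega)
| h_fixed_finite_infty (mu : R[i]) :
    reval (hpart f) (Some mu) = Some mu ->
    reval (gpart f) None = None ->
    h_fixed f (Some mu) None
| h_fixed_infty_finite (omega : R[i]) :
    reval (hpart f) None = None ->
    reval (gpart f) (Some omega) = Some omega ->
    h_fixed f None (Some omega)
| h_fixed_infty_infty :
    reval (hpart f) None = None ->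
    reval (gpart f) None = None ->
    h_fixed f None None.

(* Main.v *)
(** The holomorphic fixed point formula says that if no fixed point of a rational
    function has multiplier 1, then the numbers 1 / (1 - lambda) sum to 1 over its
    d + 1 fixed points in the sphere. A super-attracting fixed point already
    contributes 1, so the real parts of the other d >= 1 terms sum to 0 and one of
    them is not positive; since Re (1 / (1 - lambda)) > 0 as soon as
    Re lambda < 1, some fixed point has Re lambda >= 1. Taking such fixed points
    mu of h and omega of g gives the h-fixed point mu + conj omega. *)

Require Import Defs.
From mathcomp Require Import all_boot all_order all_algebra separable.
From mathcomp Require Import complex reals boolp classical_sets functions.
From mathcomp Require Import topology normedtype derive.
From mathcomp Require Import ring.

Set Implicit Arguments.
Unset Strict Implicit.

Import Order.TTheory GRing.Theory Num.Theory.
Import numFieldNormedType.Exports.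
Local Open Scope ring_scope.

(** * Derivatives of polynomials and their quotients *)

Lemma is_derive_horner (K : numFieldType) (p : {poly K}) (x : K) :
  is_derive x 1 (horner p) p^`().[x].
Proof.
elim/poly_ind: p => [|p c IH].
  rewrite deriv0 horner0.
  have -> : horner (0 : {poly K}) = cst 0 by apply/funext => y; rewrite horner0.
  exact: is_derive_cst.
have -> : horner (p * 'X + c%:P) = horner p * id + cst c.
  by apply/funext => y; rewrite !hornerE.
apply: is_derive_eq.
by rewrite derivD derivM derivX derivC !hornerE /= scaler1 addrC [_ *: _]mulrC.
Qed.

(** Agreement with the quotient is asked only off the zeros of [q]. By continuity this covers a
    neighbourhood of [z], so junk values at poles do not affect the derivative. *)
Lemma cderive_quotient (K : numFieldType) (p q : {poly K}) (u : K -> K) (z : K) :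
  (forall w, q.[w] != 0 -> u w = p.[w] / q.[w]) -> q.[z] != 0 ->
  cderive u z = (p^`().[z] * q.[z] - p.[z] * q^`().[z]) / q.[z] ^+ 2.
Proof.
move=> uE qz0; rewrite /cderive derive1E.
have dp := is_derive_horner p z; have dq := is_derive_horner q z.
have [dq1 dq2] := dq.
have q_cont : {for z, continuous (horner q)}.
  by apply/differentiable_continuous/derivable1_diffP.
have near_u : \near z, u z = (horner p * (fun y => (q.[y])^-1)) z.
  have : \forall w \near z, q.[w] != 0.
    apply: (q_cont [set w | w != 0]%classic).
    exists `|q.[z]|; first by rewrite /= normr_gt0.
    by move=> y /=; apply: contraTneq => ->; rewrite subr0 ltxx.
  by apply: filterS => w /uE.
rewrite (near_eq_derive _ near_u).
have [dp1 dp2] := dp.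
rewrite deriveM //; last exact: derivableV.
rewrite deriveV // dp2 dq2 /=.
by rewrite /GRing.scale /=; field.
Qed.

(** * Lagrange interpolation *)

(* The left-hand side is the coefficient of degree (size s).-1 in Lagrange's
   formula for the interpolation of q at s. *)
Lemma sum_residues_simple_roots (F : fieldType) (s : seq F) (q : {poly F}) :
  uniq s -> (size q <= size s)%N ->
  \sum_(x <- s) q.[x] / (\prod_(y <- s) ('X - y%:P))^`().[x]
    = q`_(size s).-1.
Proof.
move=> us sq; set P := \prod_(y <- s) _.
pose C x := \prod_(y <- rem x s) ('X - y%:P).
have PE x : x \in s -> P = ('X - x%:P) * C x.
  by move=> xs; rewrite /P (perm_big _ (perm_to_rem xs)) big_cons.
have dP x : x \in s -> P^`().[x] = (C x).[x].
  by move=> xs; rewrite (PE x xs) derivM derivXsubC !hornerE subrr mul0r addr0.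
have Cxy x y : y \in s -> x != y -> (C x).[y] = 0.
  move=> ys xy; apply/eqP; rewrite -/(root _ _) root_prod_XsubC.
  by rewrite mem_rem_uniq // !inE eq_sym xy.
have Cxx x : x \in s -> (C x).[x] != 0.
  move=> xs; rewrite -/(root _ _) root_prod_XsubC.
  by rewrite mem_rem_uniq // !inE eqxx.
have sC x : x \in s -> size (C x) = size s.
  move=> xs; rewrite size_prod_XsubC size_rem // prednK //.
  by case: (s) xs.
(* The Lagrange interpolant of [q] at [s]: [C x] vanishes on [s] except at [x], where it equals the
   derivative of [P]. *)
pose L := \sum_(x <- s) (q.[x] / P^`().[x]) *: C x.
have sL : (size L <= size s)%N.
  rewrite /L big_seq; apply: (big_ind (fun r : {poly F} => (size r <= size s)%N)).
  - by rewrite size_poly0.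
  - by move=> a b ha hb; rewrite (leq_trans (size_polyD _ _)) // geq_max ha.
  - by move=> x xs; rewrite (leq_trans (size_scale_leq _ _)) // sC.
have Lq : L - q = 0.
  apply: (@roots_geq_poly_eq0 _ _ s) => //; last first.
    by rewrite (leq_trans (size_polyD _ _)) // size_polyN geq_max sL.
  apply/allP => y ys; rewrite rootE !hornerE horner_sum subr_eq0.
  rewrite (bigD1_seq y) //= big_seq_cond big1 ?addr0.
    by rewrite hornerZ dP // divfK // Cxx.
  by move=> x /andP[xs xy]; rewrite hornerZ Cxy ?mulr0.
have -> : q`_(size s).-1 = L`_(size s).-1.
  by congr (polyseq _)`_ _; apply/esym/eqP; rewrite -subr_eq0 Lq.
(* Each [C x] is monic of size [size s], so its coefficient here is 1. *)
rewrite coef_sum big_seq [RHS]big_seq; apply: eq_bigr => x xs.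
rewrite coefZ -[(C x)`_ _]/(_`_(size s).-1) -{1}(sC x xs).
by rewrite -lead_coefE (monicP (monic_prod_XsubC _ _ _)) mulr1.
Qed.

(** * Real parts and sums of positive terms *)

Lemma Re_inv_gt0 (R : realType) (z : R[i]) :
  0 < complex.Re z -> 0 < complex.Re z^-1.
Proof.
case: z => a b /= a0; rewrite divr_gt0 //.
by rewrite ltr_wpDr ?sqr_ge0 // exprn_gt0.
Qed.

(** Removing one entry 1 leaves positive numbers with sum 0, hence nothing. *)
Lemma size_le1_of_pos_sum1 (R : numDomainType) (s : seq R) :
  (forall x, x \in s -> 0 < x) -> 1 \in s -> \sum_(x <- s) x = 1 ->
  (size s <= 1)%N.
Proof.
move=> s_gt0 s1; rewrite (perm_big _ (perm_to_rem s1)) big_cons /=.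
move/eqP; rewrite -subr_eq0 [1 + _]addrC addrK => sum0.
have rem_gt0 x : x \in rem 1 s -> 0 < x by move/mem_rem/s_gt0.
have: size (rem 1 s) = (size s).-1 by rewrite size_rem.
case: (rem 1 s) sum0 rem_gt0 => [_ _|a t]; first by case: (size s) => [|[]].
rewrite big_cons => /eqP sum0 at_gt0.
have: 0 < a + \sum_(x <- t) x.
  rewrite ltr_wpDr ?at_gt0 ?inE ?eqxx // big_seq sumr_ge0 // => x xt.
  by rewrite ltW // at_gt0 // inE xt orbT.
by rewrite sum0 ltxx.
Qed.

(** * Reversed polynomials, for the coordinate at infinity *)

(** This is z^n p(1/z) when deg p <= n. The formal degree [n] is a parameter so that numerator and
    denominator can be reversed with the same power of z. *)
Definition recip_poly (K : nzRingType) (n : nat) (p : {poly K}) : {poly K} :=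
  \poly_(i < n.+1) p`_(n - i).

Lemma horner_recip (K : fieldType) (n : nat) (p : {poly K}) (z : K) :
  (size p <= n.+1)%N -> z != 0 -> (recip_poly n p).[z] = z ^+ n * p.[z^-1].
Proof.
move=> sp z0; rewrite horner_poly (horner_coef_wide _ sp) mulr_sumr.
rewrite (reindex_inj rev_ord_inj) /=; apply: eq_bigr => i _.
have le_in : (i <= n)%N by rewrite -ltnS.
rewrite subSS subKn // exprVn mulrCA; congr (_ * _).
by rewrite exprB // unitfE.
Qed.

Lemma horner_recip0 (K : nzRingType) (n : nat) (p : {poly K}) :
  (recip_poly n p).[0] = p`_n.
Proof. by rewrite horner_coef0 coef_poly subn0. Qed.

Lemma horner_deriv_recip0 (K : nzRingType) (n : nat) (p : {poly K}) :
  (0 < n)%N -> (recip_poly n p)^`().[0] = p`_n.-1.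
Proof. by move=> n0; rewrite horner_coef0 coef_deriv coef_poly ltnS n0 subn1. Qed.

(** * Fixed points of a rational function and their multipliers *)

Section FixedPoints.
Variables (R : realType) (r : ratfun R).
Local Notation P := (rnum r).
Local Notation Q := (rden r).

Lemma multiplier_finite (z : R[i]) : Q.[z] != 0 ->
  multiplier r (Some z) = (P^`().[z] * Q.[z] - P.[z] * Q^`().[z]) / Q.[z] ^+ 2.
Proof.
move=> Qz; apply: cderive_quotient => // w Qw.
by rewrite /= (negbTE Qw).
Qed.

(** In the coordinate 1/z, [r] becomes reversed [Q] over reversed [P], with n = deg P. The numerator
    vanishes at 0 since deg Q < n, so the derivative there is the numerator's derivative over the
    denominator. *)
Lemma multiplier_infty : (size Q < size P)%N ->
  multiplier r None = Q`_(size P).-2 / lead_coef P.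
Proof.
move=> sQP; set n := (size P).-1.
have sQ : (0 < size Q)%N by rewrite lt0n size_poly_eq0 rden_neq0.
have n_gt0 : (0 < n)%N by rewrite /n; case: (size P) sQP sQ => [|[|]] //; case: (size Q).
have sP : size P = n.+1 by rewrite /n; case: (size P) sQP.
have sQn : (size Q <= n)%N by rewrite -ltnS -sP.
have P0 : lead_coef P != 0 by rewrite lead_coef_eq0 -size_poly_eq0 sP.
have recP0 : (recip_poly n P).[0] = lead_coef P by rewrite horner_recip0.
rewrite /multiplier (@cderive_quotient _ (recip_poly n Q) (recip_poly n P)).
- rewrite recP0 horner_recip0 horner_deriv_recip0 // [Q`_n]nth_default //.
  by rewrite mul0r subr0 expr2 invfM mulrA mulfK.
- move=> w; have [->|w0] := eqVneq w 0.
    move=> _; rewrite horner_recip0 [Q`_n]nth_default // mul0r /=.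
    by rewrite eqxx /= sQP /=.
  rewrite !horner_recip ?sP // 1?ltnW // mulf_eq0 negb_or => /andP[wn Pw].
  (* If 1/w is a pole of [r], [sphere_inv] sends infinity to 0, which is also the value of the
     quotient. *)
  rewrite /= (negbTE w0) /=; case: ifPn => [/eqP ->|Qw] /=.
    by rewrite mulr0 mul0r.
  rewrite mulf_eq0 invr_eq0 (negbTE Pw) (negbTE Qw) /= invf_div.
  by rewrite invfM mulrACA divff // mul1r.
- by rewrite recP0.
Qed.

Local Notation F := (P - 'X * Q).

(** A common zero of [F] and [Q] would be a zero of [P], against coprimality. *)
Lemma root_fixed (z : R[i]) : root F z -> Q.[z] != 0.
Proof.
rewrite rootE !hornerE subr_eq0 => /eqP PQ; apply/negP => /eqP Qz.
have := coprimep_root (rcoprime r) (x := z).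
by rewrite rootE PQ Qz mulr0 !eqxx => /(_ isT).
Qed.

Lemma fixed_finiteP (z : R[i]) : reval r (Some z) = Some z <-> root F z.
Proof.
split=> [|Fz].
  rewrite /=; case: ifPn => // Qz [Ez].
  by rewrite rootE !hornerE -{2}Ez divfK // subrr.
have Qz := root_fixed Fz; move: Fz; rewrite rootE !hornerE subr_eq0 => /eqP Pz.
by rewrite /= (negbTE Qz) Pz mulfK.
Qed.

(** Where P = z Q, the quotient rule gives lambda = (P' - z Q') / Q, while F' = P' - Q - z Q'. Hence
    a multiplier other than 1 makes the root simple. *)
Lemma fixed_multiplier (z : R[i]) : root F z ->
  F^`().[z] = (multiplier r (Some z) - 1) * Q.[z].
Proof.
move=> Fz; have Qz := root_fixed Fz; rewrite multiplier_finite //.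
move: Fz; rewrite rootE !hornerE subr_eq0 => /eqP ->.
by rewrite derivB derivM derivX !hornerE; field.
Qed.

(* With F = P - z Q, a finite fixed point z has 1 / (1 - lambda) = - Q(z) / F'(z),
   so the sum is read off the partial fraction expansion of Q / F. *)
Lemma finite_fixed_points : (size Q < size F)%N ->
  (forall z, reval r (Some z) = Some z -> multiplier r (Some z) != 1) ->
  exists zs : seq R[i],
    [/\ uniq zs, size zs = (size F).-1,
        forall z, z \in zs <-> reval r (Some z) = Some z
      & \sum_(z <- zs) (1 - multiplier r (Some z))^-1
          = - (Q`_(size F).-2 / lead_coef F)].
Proof.
move=> sQF mult_neq1; have [zs Fzs] := closed_field_poly_normal F.
have F0 : F != 0 by rewrite -size_poly_eq0; case: (size F) sQF.
have lF : lead_coef F != 0 by rewrite lead_coef_eq0.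
have szs : size F = (size zs).+1.
  by rewrite Fzs size_scale // size_prod_XsubC.
have zsP z : (z \in zs) = root F z by rewrite Fzs rootZ // root_prod_XsubC.
have dF z : z \in zs -> F^`().[z] != 0.
  move=> zzs; rewrite fixed_multiplier -?zsP // mulf_neq0 //.
    by rewrite subr_eq0 mult_neq1 //; apply/fixed_finiteP; rewrite -zsP.
  by apply: root_fixed; rewrite -zsP.
have uzs : uniq zs.
  rewrite -separable_prod_XsubC unlock; apply/Pdiv.ClosedField.coprimepP => z.
  rewrite root_prod_XsubC => /dF; rewrite {1}Fzs derivZ hornerZ.
  by rewrite mulf_eq0 negb_or => /andP[].
exists zs; split=> //.
- by rewrite szs.
- by move=> z; rewrite zsP; split=> /fixed_finiteP.
rewrite szs /= -sum_residues_simple_roots //; last by rewrite -ltnS -szs.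
rewrite mulr_suml -sumrN big_seq [RHS]big_seq; apply: eq_bigr => z zzs.
have := fixed_multiplier; move/(_ z); rewrite -zsP => /(_ zzs) dFE.
have Qz : Q.[z] != 0 by apply: root_fixed; rewrite -zsP.
(* [F] is [lead_coef F] times the monic product of the Lagrange formula, so this factor turns the
   derivative of the product into F'. *)
rewrite -mulrA -invfM [_ * lead_coef _]mulrC -hornerZ -derivZ -Fzs dFE.
by rewrite invfM mulrCA divff // mulr1 -opprB invrN.
Qed.

(** The proof splits on whether infinity is fixed, which decides the degree of [F] and whether
    infinity adds a term. *)
Lemma fixed_point_formula :
  (forall w : option R[i], reval r w = w -> multiplier r w != 1) ->
  exists ws : seq (option R[i]),
    [/\ uniq ws, size ws = (rdegree r).+1,
        forall w, w \in ws <-> reval r w = w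
      & \sum_(w <- ws) (1 - multiplier r w)^-1 = 1].
Proof.
move=> mult_neq1.
have fin_neq1 z : reval r (Some z) = Some z -> multiplier r (Some z) != 1.
  exact: mult_neq1.
have Q0 := rden_neq0 r.
have sQ : (0 < size Q)%N by rewrite lt0n size_poly_eq0.
have [sPQ|sQP] := leqP (size P) (size Q).
(* Infinity is not fixed: the term z Q dominates [F], and the finite sum is already 1. *)
- have sXQ : size ('X * Q) = (size Q).+1 by rewrite mulrC size_mulX.
  have sP_XQ : (size P < size (- ('X * Q)))%N by rewrite size_polyN sXQ.
  have sF : size F = (size Q).+1 by rewrite addrC size_polyDl // size_polyN.
  have lF : lead_coef F = - lead_coef Q.
    by rewrite addrC lead_coefDl // lead_coefN mulrC lead_coefMX.
  have [|zs [uzs szs zsP sum_zs]] := finite_fixed_points _ fin_neq1.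
    by rewrite sF.
  exists [seq Some z | z <- zs]; split.
  + by rewrite map_inj_uniq // => a b [].
  + rewrite size_map szs sF /rdegree (maxn_idPr _) ?prednK //.
    by rewrite -!subn1 leq_sub2r.
  + move=> w; split=> [/mapP[z /zsP zfix ->] //|].
    case: w => [z /zsP zzs|]; first by rewrite map_f.
    by rewrite /= ltnNge sPQ.
  + rewrite big_map sum_zs sF lF /= -lead_coefE invrN mulrN opprK divff //.
    by rewrite lead_coef_eq0.
(* Infinity is fixed with multiplier c: the finite sum is - c / (1 - c), and infinity adds 1 / (1 -
   c). *)
- set n := (size P).-1; have sP : size P = n.+1 by rewrite /n; case: (size P) sQP.
  have sQn : (size Q <= n)%N by rewrite -ltnS -sP.
  have n_gt0 : (0 < n)%N := leq_trans sQ sQn.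
  have P0 : lead_coef P != 0 by rewrite lead_coef_eq0 -size_poly_eq0 sP.
  have inf_fixed : reval r None = None by rewrite /= sQP.
  have := mult_neq1 None inf_fixed; have := multiplier_infty sQP.
  rewrite sP; set c := multiplier r None => cE c1.
  have Qn : Q`_n.-1 = c * lead_coef P by rewrite cE divfK.
  (* Since c is not 1, the top terms of [P] and z Q do not cancel, so [F] keeps degree [n]. *)
  have Fn : F`_n = (1 - c) * lead_coef P.
    rewrite coefB coefXM eqn0Ngt n_gt0 /= Qn mulrBl mul1r.
    by rewrite lead_coefE sP.
  have c1' : 1 - c != 0 by rewrite subr_eq0 eq_sym.
  have sF : size F = n.+1.
    apply/eqP; rewrite eqn_leq; apply/andP; split.
      rewrite (leq_trans (size_polyD _ _)) // size_polyN mulrC size_mulX //.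
      by rewrite geq_max sP leqnn.
    rewrite ltnNge; apply/negP => /(nth_default 0) /eqP.
    by rewrite Fn mulf_eq0 (negbTE c1') (negbTE P0).
  have [|zs [uzs szs zsP sum_zs]] := finite_fixed_points _ fin_neq1.
    by rewrite sF.
  exists (None :: [seq Some z | z <- zs]); split.
  + rewrite /= map_inj_uniq ?uzs ?andbT; last by move=> a b [].
    by apply/mapP => -[].
  + rewrite /= size_map szs sF /rdegree (maxn_idPl _) ?sP //.
    by rewrite -!subn1 leq_sub2r // -sP ltnW.
  + move=> w; rewrite inE; split=> [/orP[/eqP ->|/mapP[z /zsP zfix ->]] //|].
    by case: w => [z /zsP zzs|//]; rewrite map_f ?orbT.
  + rewrite big_cons big_map sum_zs sF -/c Qn (lead_coefE F) sF Fn.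
    by field; rewrite P0 c1'.
Qed.

(** By contradiction: if every Re lambda < 1, all real parts in the formula are positive and the
    super-attracting point alone gives 1. It would then be the only fixed point, against the count d
    + 1. *)
Lemma superattracting_ex_Re_ge1 :
  (1 < rdegree r)%N -> has_superattracting_fixed_point r ->
  exists w : option R[i],
    reval r w = w /\ 1 <= complex.Re (multiplier r w).
Proof.
move=> deg_r [w0 [w0_fixed w0_super]]; apply: contrapT => no_w.
have Re_lt1 w : reval r w = w -> complex.Re (multiplier r w) < 1.
  by move=> wfix; rewrite ltNge; apply/negP => Re_ge1; apply: no_w; exists w.
have [|ws [_ sws wsP sum_ws]] := fixed_point_formula.
  by move=> w /Re_lt1; apply: contraTneq => ->; rewrite ltxx.
pose s := [seq complex.Re (1 - multiplier r w)^-1 | w <- ws].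
have: (size s <= 1)%N.
  apply: size_le1_of_pos_sum1.
  - move=> _ /mapP[w /wsP /Re_lt1 Re_w ->]; apply: Re_inv_gt0.
    by rewrite raddfB /= subr_gt0.
  - apply/mapP; exists w0; first exact/wsP.
    by rewrite w0_super subr0 invr1.
  - rewrite big_map -(@big_morph _ _ (@complex.Re R) 0 +%R 0 +%R) ?sum_ws //.
    by case=> [a b] [c d].
by rewrite size_map sws ltnS leqNgt (ltnW deg_r).
Qed.
End FixedPoints.

(** * Polynomials, and passage to h-fixed points *)

(** The point is infinity: the denominator 1 has coefficient 0 in degree deg p - 1 >= 1. *)
Lemma has_superattracting_poly (R : realType) (p : {poly R[i]}) :
  (1 < (size p).-1)%N -> has_superattracting_fixed_point (ratfun_of_poly p).
Proof.
move=> deg_p; have sp : (2 < size p)%N by case: (size p) deg_p.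
have sp1 : (size (1%R : {poly R[i]}) < size p)%N.
  by rewrite size_poly1 (ltn_trans _ sp).
exists None; split; first by rewrite /= sp1.
rewrite multiplier_infty //= coef1.
by case: (size p) sp => [|[|[|n]]] //= _; rewrite mul0r.
Qed.

Lemma rdegree_poly (R : realType) (p : {poly R[i]}) :
  rdegree (ratfun_of_poly p) = (size p).-1.
Proof. by rewrite /rdegree /= size_poly1 maxn0. Qed.

Lemma h_fixed_of_fixed (R : realType) (f : harmonic R) (mu omega : sphere R) :
  reval (hpart f) mu = mu -> reval (gpart f) omega = omega ->
  h_fixed f mu omega.
Proof.
case: mu omega => [mu|] [omega|] hmu gomega; last 3 first.
- exact: h_fixed_finite_infty.
- exact: h_fixed_infty_finite.
- exact: h_fixed_infty_infty.
exact: h_fixed_finite hmu gomega erefl.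
Qed.

Theorem theorem3 (R : realType) :
  (forall f : harmonic R,
     rational_harmonic f ->
     has_superattracting_fixed_point (hpart f) ->
     has_superattracting_fixed_point (gpart f) ->
     exists mu omega : sphere R,
       [/\ h_fixed f mu omega,
           1 <= complex.Re (multiplier (hpart f) mu)
         & 1 <= complex.Re (multiplier (gpart f) omega)])
  /\
  (forall p q : {poly R[i]},
     (2 <= (size p).-1)%N -> (2 <= (size q).-1)%N ->
     let f := Harmonic (ratfun_of_poly p) (ratfun_of_poly q) in
     exists mu omega : sphere R,
       [/\ h_fixed f mu omega,
           1 <= complex.Re (multiplier (hpart f) mu)
         & 1 <= complex.Re (multiplier (gpart f) omega)]).
Proof.
have rational_case (f : harmonic R) : rational_harmonic f ->
    has_superattracting_fixed_point (hpart f) ->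
    has_superattracting_fixed_point (gpart f) ->
    exists mu omega : sphere R,
      [/\ h_fixed f mu omega,
          1 <= complex.Re (multiplier (hpart f) mu)
        & 1 <= complex.Re (multiplier (gpart f) omega)].
  move=> [deg_h deg_g] super_h super_g.
  have [mu [mu_fixed Re_mu]] := superattracting_ex_Re_ge1 deg_h super_h.
  have [om [om_fixed Re_om]] := superattracting_ex_Re_ge1 deg_g super_g.
  by exists mu, om; split=> //; apply: h_fixed_of_fixed.
split=> [//|p q deg_p deg_q f]; apply: rational_case.
- by split; rewrite rdegree_poly.
- exact: has_superattracting_poly.
- exact: has_superattracting_poly.
Qed.
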